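(* Let $s \geq 1$. A partial order $\mathcal{P} = (V, R)$ with root $r$ has an arboreal extension $\mathcal{A} = (V, R')$ with $s$ jumps if and only if there is a partition $\pi = \{\pi_1, \pi_2, \ldots, \pi_{s+1}\}$ of $V$ satisfying the following properties: (1) Each $\pi_i$ induces an arboreal subposet $\mathcal{P}_i = (\pi_i, R_i)$ of $\mathcal{P}$ with root $r_i$. (2) Let $\mathcal{Q} = (\pi, T)$ be the relation induced by $\pi$, and let $B$ be the transitive closure of $T$. Then $\mathcal{P}_\pi = (\pi, B)$ is a partial order with root $r_\pi$ (so $r_\pi$ is one of the parts of $\pi$). (3) There is a function $f : \pi \setminus \{r_\pi\} \to V$ such that, for every $\pi_j \in \pi \setminus \{r_\pi\}$, $f(\pi_j) \in \pi_i$ for some $i \neq j$ and $(f(\pi_j), r_j) \notin R$, corresponding to the jumps of $\mathcal{A}$ (that is, the pairs $(f(\pi_j), r_j)$, $\pi_j \in \pi \setminus \{r_\pi\}$, are the jumps of the arboreal extension $\mathcal{A}$). Moreover, $\mathcal{A}_\pi = (\pi, B')$ is an arboreal order extension of $\mathcal{P}_\pi$, where $B'$ is the transitive closure of $$\{(\pi_i, \pi_j) \mid f(\pi_j) \in \pi_i\} \cup \{(\pi_i, \pi_i) \mid \pi_i \in \pi\}.$$ (4) Let $g : \pi \to 2^V$ be a mapping satisfying (with $f$ the function of property (3)) $$g(\pi_i) = \begin{cases} \emptyset & \text{if } \pi_i = r_\pi, \\ \{f(\pi_i)\} \cup g(\pi_j), \ \text{where } f(\pi_i) \in \pi_j, &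 \text{otherwise.} \end{cases}$$ Then for all $x \prec_{\mathcal{P}} y$ such that $x \in \pi_u$, $y \in \pi_v$, $u \neq v$, there is $z \in g(\pi_v)$ such that $(x, z) \in R_u$.
   Context: A partial order (poset) $\mathcal{P} = (V,R)$ is a pair consisting of a finite set $V$ and a reflexive, antisymmetric and transitive binary relation $R$ on $V$. Elements $x,y$ are comparable if $(x,y)\in R$ or $(y,x)\in R$, and incomparable otherwise. For $x \neq y$, $y$ covers $x$ in $\mathcal{P}$, written $x \prec_{\mathcal{P}} y$, if $(x,y) \in R$ and there is no $z \in V\setminus\{x,y\}$ with $(x,z),(z,y)\in R$. A minimal element is one that does not cover any element; if the poset has a single minimal element it is called the root (or minimum), and the poset is called rooted. The subposet of $\mathcal{P}$ induced by $U \subseteq V$ is $(U, X)$ where, for $x,y\in U$, $(x,y)\in X$ if and only if $(x,y) \in R$. A poset is a total order if every two distinct elements are comparable. An arboreal order is a poset $(V,R)$ with a minimum element such that for every $x\in V$ the subposet induced by $\{y \mid (y,x)\in R\}$ is a total order. A poset $(V,R')$ is an extension of $(V,R)$ if $R \subseteq R'$. An arboreal extension is an extension that is an arboreal order. A jump in an extension $\mathcal{A} = (V,R')$ of $\mathcal{P}=(V,R)$ is a pair $(x,y)$ with $x \prec_{\mathcal{A}} y$ such that $x$ and $y$ are incomparable in $\mathcal{P}$. Given a poset $\mathcal{P}=(V,R)$ and a partition $\pi = \{\pi_1,\ldots,\pi_m\}$ of $V$, the relation induced by $\pi$ is the pair $(\pi, T)$ in which $(\pi_i,\pi_j)\in T$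 if and only if there are $x\in\pi_i$ and $y \in \pi_j$ with $(x,y)\in R$. In property (3), $\mathcal{A}$ is the arboreal extension whose existence is being characterized: given $\mathcal{A}$, the function $f$ sends each part $\pi_j \neq r_\pi$ to the source of the jump of $\mathcal{A}$ ending in the root $r_j$ of $\pi_j$; conversely, given the partition and $f$, the extension $\mathcal{A}$ obtained has the pairs $(f(\pi_j), r_j)$ as its jumps. *)

(* Defs.v *)
From mathcomp Require Import all_boot.

Set Implicit Arguments.
Unset Strict Implicit.
Unset Printing Implicit Defensive.

(* A relation on a finite set D is encoded as a pair of D : {set T} and
   R : rel T, where the values of R outside D are irrelevant. *)
Section Posets.
Variable T : finType.
Implicit Types (D U : {set T}) (R : rel T) (x y : T).

Definition poset D R : Prop :=
  [/\ {in D, reflexive R}, {in D &, antisymmetric R}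
    & {in D & &, transitive R}].

Definition pcomparable R : rel T := [rel x y | R x y || R y x].

Definition covers D R : rel T :=
  [rel x y | [&& x \in D, y \in D, x != y, R x y
    & [forall z in D :\: [set x; y], ~~ (R x z && R z y)]]].

Definition minimal D R : pred T :=
  [pred x | (x \in D) && [forall y in D, ~~ covers D R y x]].

Definition is_root D R x : Prop := [set y | minimal D R y] = [set x].

Definition induced R U : rel T := [rel x y | [&& x \in U, y \in U & R x y]].

Definition total_order D R : Prop :=
  poset D R /\ {in D &, forall x y, x != y -> pcomparable R x y}.

Definition down D R x : {set T} := [set y in D | R y x].

Definition arboreal D R : Prop :=
  [/\ poset D R, exists x, is_root D R x
    & {in D, forall x, total_order (down D R x) (induced R (down D R x))}].

Definition extension D R R' : Prop := poset D R' /\ {in D &, subrel R R'}.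

Definition arboreal_extension D R R' : Prop :=
  extension D R R' /\ arboreal D R'.

Definition jumps D R R' : {set T * T} :=
  [set p | covers D R' p.1 p.2 && ~~ pcomparable R p.1 p.2].

(* [connect] is the reflexive transitive closure; at least one step is
   required here. *)
Definition tclosure R : rel T :=
  [rel x y | [exists z, R x z && connect R z y]].

End Posets.

Section Decomposition.
Variables (V : finType) (R : rel V).
(* P is a partition of V, rho X the root of the part X, rP the root of the
   quotient; f and rho only matter on P :\ rP and P respectively. *)
Variables (P : {set {set V}}) (rho : {set V} -> V) (rP : {set V})
  (f : {set V} -> V).

Definition quotient_rel : rel {set V} :=
  [rel X Y | [&& X \in P, Y \in P
    & [exists x in X, exists y in Y, R x y]]].

Definition quotient_closure : rel {set V} := tclosure quotient_rel.

Definition parent_rel : rel {set V} :=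
  [rel X Y | [&& X \in P, Y \in P
    & (X == Y) || (Y \in P :\ rP) && (f Y \in X)]].

Definition parent_closure : rel {set V} := tclosure parent_rel.

Definition parts_arboreal : Prop :=
  {in P, forall X,
    arboreal X (induced R X) /\ is_root X (induced R X) (rho X)}.

Definition quotient_rooted : Prop :=
  poset P quotient_closure /\ is_root P quotient_closure rP.

Definition sources_arboreal : Prop :=
  {in P :\ rP, forall X,
    (exists Y : {set V}, [/\ Y \in P, Y != X & f X \in Y]) /\ ~~ R (f X) (rho X)} /\
  arboreal_extension P quotient_closure parent_closure.

(* Uniquely determines g on P once [sources_arboreal] holds. *)
Definition ancestor_sources (g : {set V} -> {set V}) : Prop :=
  g rP = set0 /\
  {in P :\ rP & P, forall X Y : {set V},
    f X \in Y -> g X = f X |: g Y}.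

Definition sources_cover : Prop :=
  forall g, ancestor_sources g ->
  forall (x y : V) (U W : {set V}), covers [set: V] R x y ->
    U \in P -> W \in P -> x \in U -> y \in W -> U != W ->
    exists2 z, z \in g W & induced R U x z.

Definition jump_decomposition : Prop :=
  partition P [set: V] /\
  [/\ parts_arboreal, quotient_rooted, sources_arboreal & sources_cover].

Definition source_pairs : {set V * V} := [set (f X, rho X) | X in P :\ rP].

End Decomposition.

(* Main.v *)
Require Import Defs.
From mathcomp Require Import all_boot.

(* From an arboreal extension A to a partition: cut the tree A at its jumps.
   The heads are the root together with the targets of jumps; each x goes to
   the part of the greatest head below x. Inside a part all covers of A are
   comparabilities of P, so A and P agree there, and the order of the parts is
   the A-order of their heads.
   From a partition to an extension: let x precede y when they are in the same
   part and x <=_P y, or when x <=_P z for some source z in g(part of y) lying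
   in the part of x. Condition (4) says precisely that this relation contains
   the covers of P, and it is arboreal because each part is, and the tree of
   parts is. *)

Set Implicit Arguments.
Unset Strict Implicit.
Unset Printing Implicit Defensive.

(** * Closures of relations and finite posets *)

Section FinitePosets.
Variable T : finType.
Implicit Types (D : {set T}) (R E Q : rel T).

Lemma connect_min E Q :
  reflexive Q -> transitive Q -> subrel E Q -> subrel (connect E) Q.
Proof.
move=> Qrefl Qtrans sEQ x y /connectP[p]; elim: p x => [|z p IHp] x /=.
  by move=> _ ->.
by case/andP=> /sEQ Qxz /IHp/[apply]; apply: Qtrans.
Qed.

(** The path is first shortened to one without repetitions, so its first step is not a loop. This
    matters because the relations used below are reflexive. *)
Lemma connect_first E x y : connect E x y -> x != y ->
  exists z, [/\ E x z, x != z & connect E z y].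
Proof.
case/connectP=> p /shortenP[[|z q] /= Ep Up _] ->; first by rewrite eqxx.
move=> _; case/andP: Ep Up => Exz Eq /andP[]; rewrite inE negb_or.
case/andP=> xz _ _; exists z; split=> //.
by apply/connectP; exists q.
Qed.

Lemma connect_last E x y : connect E x y -> x != y ->
  exists z, [/\ connect E x z, z != y & E z y].
Proof.
case/connectP=> p /shortenP[q Ep Up _] ->.
case/lastP: q Ep Up => [|q z]; first by rewrite /= eqxx.
rewrite last_rcons rcons_path -rcons_cons rcons_uniq.
case/andP=> Eq Ez /andP[zq _] _; exists (last x q); split=> //.
- by apply/connectP; exists q.
- by apply: contraNneq zq => <-; apply: mem_last.
Qed.

(** The one step that [tclosure] demands can be a loop at [x], so the path lemmas for [connect]
    become available. *)
Lemma tclosureE D E : {in D, reflexive E} ->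
  {in D, forall x y, tclosure E x y = connect E x y}.
Proof.
move=> Erefl x Dx y; apply/existsP/idP => [[z /andP[Exz]]|cxy].
  exact: connect_trans (connect1 Exz).
by exists x; rewrite Erefl.
Qed.

Section OnePoset.
Variables (D : {set T}) (R : rel T).
Hypothesis posR : poset D R.

Lemma poset_refl x : x \in D -> R x x.
Proof. by case: posR => Rr _ _; apply: Rr. Qed.

Lemma poset_anti x y : x \in D -> y \in D -> R x y -> R y x -> x = y.
Proof.
by case: posR => _ Ra _ Dx Dy Rxy Ryx; apply: Ra => //; rewrite Rxy.
Qed.

Lemma poset_trans y x z : x \in D -> y \in D -> z \in D ->
  R x y -> R y z -> R x z.
Proof. by case: posR => _ _ Rt Dx Dy Dz; apply: Rt. Qed.

Lemma ltn_card_down x y : x \in D -> y \in D -> R x y -> x != y ->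
  #|down D R x| < #|down D R y|.
Proof.
move=> Dx Dy Rxy xy; apply: proper_card; apply/properP; split.
  apply/subsetP=> z; rewrite !inE => /andP[Dz Rzx]; rewrite Dz.
  exact: poset_trans Rxy.
exists y; rewrite !inE Dy ?poset_refl //=.
by apply: contraNN xy => Ryx; apply/eqP/poset_anti.
Qed.

(** Well-founded induction along the strict order, measured by the size of the down-set, which grows
    strictly. *)
Lemma poset_ind (S : T -> Prop) :
  (forall y, y \in D -> (forall x, x \in D -> R x y -> x != y -> S x) -> S y) ->
  forall y, y \in D -> S y.
Proof.
move=> IH y; have [n] := ubnP #|down D R y|; elim: n y => // n IHn y.
rewrite ltnS => le_n Dy; apply: IH => // x Dx Rxy xy.
by apply: IHn => //; apply: leq_trans le_n; apply: ltn_card_down.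
Qed.

Lemma coversP x y : reflect
  [/\ x \in D, y \in D, x != y, R x y
    & forall z, z \in D -> R x z -> R z y -> z = x \/ z = y]
  (covers D R x y).
Proof.
apply: (iffP and5P) => -[Dx Dy xy Rxy btw]; split=> //.
  move=> z Dz Rxz Rzy; move/forall_inP/(_ z): btw.
  rewrite !inE Dz andbT negb_or Rxz Rzy /=.
  by case: eqP => [|_]; [left|case: eqP => [|_ /(_ isT)]; [right|]].
apply/forall_inP=> z; rewrite !inE negb_or -andbA => /and3P[zx zy Dz].
apply/negP=> /andP[Rxz Rzy].
by case: (btw z Dz Rxz Rzy) => /eqP; [rewrite (negPf zx)|rewrite (negPf zy)].
Qed.

Lemma covers_below x y : x \in D -> y \in D -> R x y -> x != y ->
  exists2 p, covers D R p y & R x p.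
Proof.
move=> Dx Dy Rxy xy.
(* The lower cover is an element of the interval from [x] to [y], with [y] left out, whose down-set
   is largest. *)
pose B p := [&& p \in D, R x p, R p y & p != y].
have Bx : B x by rewrite /B Dx poset_refl // Rxy.
case: (@arg_maxnP _ x B (fun p => #|down D R p|) Bx).
move=> p /and4P[Dp Rxp Rpy py] maxp; exists p => //.
apply/coversP; split=> // z Dz Rpz Rzy.
have [->|zy] := eqVneq z y; first by right.
left; have [//|zp] := eqVneq z p.
have: B z by rewrite /B Dz Rzy zy (poset_trans _ Dp _ Rxp).
by move/maxp; rewrite /= leqNgt ltn_card_down // eq_sym.
Qed.

(** By finiteness a unique minimal element is a minimum: any other element covers something, and
    descending through covers ends at [x]. *)
Lemma is_rootP x : is_root D R x <-> x \in D /\ {in D, forall y, R x y}.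
Proof.
split=> [root_x|[Dx minx]].
  have Dx : x \in D.
    by move/setP/(_ x): root_x; rewrite !inE eqxx /= => /andP[].
  split=> //; apply: poset_ind => y Dy IHy.
  have [->|yx] := eqVneq y x; first exact: poset_refl.
  move/setP/(_ y): root_x; rewrite !inE (negPf yx) /= /minimal /= Dy => /negbT.
  case/forall_inPn=> z Dz; rewrite negbK => /coversP[_ _ zy Rzy _].
  exact: poset_trans (IHy z Dz Rzy zy) Rzy.
apply/setP=> y; rewrite !inE; apply/andP/eqP => [[Dy /forall_inP miny]|->].
  apply/eqP; apply: contraT => yx; rewrite eq_sym in yx.
  have [p /[dup] /coversP[Dp _ _ _ _] + _] := covers_below Dx Dy (minx y Dy) yx.
  by rewrite (negPf (miny p Dp)).
split=> //; apply/forall_inP=> z Dz; apply/coversP=> -[_ _ zx Rzx _].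
by case/eqP: zx; apply: poset_anti => //; apply: minx.
Qed.

Lemma poset_induced (U : {set T}) : U \subset D -> poset U (induced R U).
Proof.
move=> /subsetP sUD; rewrite /induced.
split=> [x Ux|x y Ux Uy|y x z Uy Ux Uz] /=.
- by rewrite Ux poset_refl ?sUD.
- by rewrite Ux Uy => /andP[]; apply: poset_anti; apply: sUD.
by rewrite Ux Uy Uz /=; apply: poset_trans; apply: sUD.
Qed.

(** The working form of arboreality: two elements with a common upper bound are comparable. *)
Lemma arborealP : arboreal D R <->
  (exists x, is_root D R x) /\
  {in D & &, forall x y z, R y x -> R z x -> R y z || R z y}.
Proof.
have sub_down x : down D R x \subset D.
  by apply/subsetP=> y; rewrite inE => /andP[].
split=> [[_ rooted chain]|[rooted chain]]; split=> //.
  move=> x y z Dx Dy Dz Ryx Rzx.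
  have [->|yz] := eqVneq y z; first by rewrite poset_refl.
  have [_ /(_ y z)] := chain x Dx.
  rewrite /pcomparable /induced /= !inE Dy Dz Ryx Rzx /=.
  by move/(_ isT isT yz).
move=> x Dx; split; first exact: poset_induced (sub_down x).
move=> y z; rewrite /pcomparable /induced /= !inE.
move=> /andP[Dy Ryx] /andP[Dz Rzx] _.
by rewrite Dy Dz Ryx Rzx /= (chain x).
Qed.

End OnePoset.
End FinitePosets.

(** * From a decomposition to an arboreal extension *)

Section Construction.
Variables (V : finType) (R : rel V) (r : V).
Hypotheses (posR : poset [set: V] R) (root_r : is_root [set: V] R r).
Variables (P : {set {set V}}) (rho : {set V} -> V) (rP : {set V})
  (f : {set V} -> V).
Hypothesis dec : jump_decomposition R P rho rP f.

Let part x : {set V} := pblock P x.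
Let ple : rel {set V} := parent_closure P rP f.

Let partP x : part x \in P.
Proof. by case: dec => /and3P[/eqP cP _ _] _; rewrite pblock_mem ?cP. Qed.

Let mem_part x : x \in part x.
Proof. by case: dec => /and3P[/eqP cP _ _] _; rewrite mem_pblock cP. Qed.

Let part_eq X x : X \in P -> x \in X -> part x = X.
Proof. by case: dec => /and3P[_ tP _] _; apply: def_pblock. Qed.

Let part_root X : X \in P -> is_root X (induced R X) (rho X).
Proof. by case: dec => _ [+ _ _ _] XP => /(_ X XP)[]. Qed.

Let poset_part X : poset X (induced R X).
Proof. exact: (poset_induced posR (subsetT X)). Qed.

Let mem_rho X : X \in P -> rho X \in X.
Proof. by move/part_root/(is_rootP (poset_part X))=> []. Qed.

Let rho_min X x : X \in P -> x \in X -> R (rho X) x.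
Proof.
move/part_root/(is_rootP (poset_part X))=> [_ minX] /minX.
by case/and3P.
Qed.

Let part_chain x y z : part y = part x -> part z = part x ->
  R y x -> R z x -> R y z || R z y.
Proof.
move=> yx zx Ryx Rzx; case: dec => _ [/(_ _ (partP x))[+ _] _ _ _].
have Yx : y \in part x by rewrite -yx.
have Zx : z \in part x by rewrite -zx.
move/(arborealP (poset_part _))=> [_ /(_ x y z)].
by rewrite /induced /= mem_part Yx Zx Ryx Rzx; apply.
Qed.

Let ple_ext : arboreal_extension P (quotient_closure R P) ple.
Proof. by case: dec => _ [_ _ [_ ext] _]. Qed.

Let poset_ple : poset P ple.
Proof. by case: ple_ext => -[]. Qed.

Let ple_chain X Y Z : X \in P -> Y \in P -> Z \in P ->
  ple Y X -> ple Z X -> ple Y Z || ple Z Y.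
Proof.
case: ple_ext => _ /(arborealP poset_ple)[_ chain] XP YP ZP.
exact: chain.
Qed.

Let pleE X Y : X \in P -> ple X Y = connect (parent_rel P rP f) X Y.
Proof.
move=> XP; apply: (tclosureE _ XP) => {}X {}XP.
by rewrite /parent_rel /= XP eqxx.
Qed.

Let in_part X : X \in P :\ rP -> X \in P.
Proof. by case/setD1P. Qed.

Let ple_source X : X \in P :\ rP -> ple (part (f X)) X.
Proof.
move=> X1; rewrite pleE ?partP // connect1 //= /parent_rel /=.
by rewrite partP in_part // X1 mem_part orbT.
Qed.

Let source_part X : X \in P :\ rP -> part (f X) != X.
Proof.
case: dec => _ [_ _ [srcP _] _] /srcP[[Y [YP YX fY]] _].
by rewrite (part_eq YP fY).
Qed.

Let source_notR X : X \in P :\ rP -> ~~ R (f X) (rho X).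
Proof. by case: dec => _ [_ _ [srcP _] _] /srcP[]. Qed.

(** The only non-loop step into [Y] comes from its parent [part (f Y)], so a path from another part
    ends with that step. *)
Let ple_below X Y : X \in P -> Y \in P -> ple X Y -> X != Y ->
  Y \in P :\ rP /\ ple X (part (f Y)).
Proof.
move=> XP YP; rewrite pleE // => /connect_last/[apply].
case=> Z [XZ ZY /and3P[ZP _]].
rewrite (negPf ZY) /= => /andP[Y1 fY]; split=> //.
by rewrite (part_eq ZP fY) pleE.
Qed.

Let ple_above X Y : X \in P -> ple X Y -> X != Y ->
  exists Z, [/\ Z \in P :\ rP, part (f Z) = X & ple Z Y].
Proof.
move=> XP; rewrite pleE // => /connect_first/[apply] -[Z [/and3P[_ ZP]]].
move=> + XZ; rewrite (negPf XZ) /= => /andP[Z1 fZ] ZY.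
by exists Z; rewrite Z1 (part_eq XP fZ) pleE.
Qed.

Let ple_trans Y X Z : X \in P -> Y \in P -> Z \in P ->
  ple X Y -> ple Y Z -> ple X Z.
Proof. by move=> XP YP ZP; apply: (poset_trans poset_ple). Qed.
Let ple_anti X Y : X \in P -> Y \in P -> ple X Y -> ple Y X -> X = Y.
Proof. exact: (poset_anti poset_ple). Qed.

(** Closed form of the recursive map [g] of condition (4): the sources of all non-root ancestors of
    [X], including [X] itself. *)
Let sources X : {set V} := [set f Z | Z in P :\ rP & ple Z X].

Let sources_ancestor : ancestor_sources P rP f sources.
Proof.
split.
  apply/setP=> z; rewrite inE; apply/negbTE/negP.
  case/imsetP=> Z /[!inE] /andP[/andP[ZrP ZP] le_Z _].
  have rPP : rP \in P.
    move: le_Z; rewrite pleE // => /connect_last/(_ ZrP)[? [_ _]].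
    by case/and3P.
  by have [] := ple_below ZP rPP le_Z ZrP; rewrite !inE eqxx.
move=> X Y X1 YP fX; have XP := in_part X1.
have def_Y := part_eq YP fX.
apply/setP=> z; rewrite in_setU1.
apply/imsetP/predU1P=> [[Z /setIdP[Z1 leZX] ->]|[->|]].
- have [->|ZX] := eqVneq Z X; [by left | right].
  have [_] := ple_below (in_part Z1) XP leZX ZX; rewrite def_Y => leZY.
  by apply/imsetP; exists Z => //; apply/setIdP.
- exists X => //; apply/setIdP; split=> //.
  exact: poset_refl poset_ple _ XP.
case/imsetP=> Z /setIdP[Z1 leZY] ->; exists Z => //; apply/setIdP; split=> //.
apply: (ple_trans (in_part Z1) YP XP leZY).
by rewrite -def_Y ple_source.
Qed.

(** The extension to be built. A source in [g (part y)] is represented by an ancestor [Z] of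
    [part y] with that source. *)
Let le : rel V := [rel x y | (part x == part y) && R x y
  || [exists Z in P :\ rP,
        [&& ple Z (part y), part (f Z) == part x & R x (f Z)]]].

Let leP x y : reflect
  ((part x = part y /\ R x y) \/
   exists Z, [/\ Z \in P :\ rP, ple Z (part y), part (f Z) = part x
               & R x (f Z)])
  (le x y).
Proof.
apply: (iffP orP) => -[].
- by case/andP=> /eqP; left.
- by case/exists_inP=> Z Z1 /and3P[leZ /eqP fZ RxZ]; right; exists Z.
- by case=> /eqP xy Rxy; left; apply/andP.
case=> Z [Z1 leZ /eqP fZ RxZ]; right; apply/exists_inP; exists Z => //.
exact/and3P.
Qed.

Let R_refl x : R x x. Proof. exact: poset_refl posR _ (in_setT x). Qed.
Let R_trans y x z : R x y -> R y z -> R x z.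
Proof. exact: (poset_trans posR) (in_setT _) (in_setT _) (in_setT _). Qed.
Let R_anti x y : R x y -> R y x -> x = y.
Proof. exact: (poset_anti posR) (in_setT _) (in_setT _). Qed.

Let le_part x y : le x y -> ple (part x) (part y).
Proof.
case/leP=> [[-> _]|[Z [Z1 leZ <- _]]]; first exact: poset_refl poset_ple _ _.
by apply: (ple_trans _ _ _ _ leZ); rewrite ?partP ?in_part ?ple_source.
Qed.

(** If both parts were equal, [Z] would lie below its own parent [part (f Z)] in the tree. Hence
    inside a part only the first disjunct of [le] can occur. *)
Let le_source_part x Z y : Z \in P :\ rP -> part (f Z) = part x ->
  ple Z (part y) -> part x != part y.
Proof.
move=> Z1 fZ leZ; apply: contraNneq (source_part Z1) => xy.
apply/eqP/ple_anti; rewrite ?partP ?in_part ?ple_source //.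
by rewrite fZ xy.
Qed.

Let le_anti x y : le x y -> le y x -> x = y.
Proof.
move=> lexy leyx.
have xy : part x = part y by apply: ple_anti; rewrite ?partP ?le_part.
have same u v : part u = part v -> le u v -> R u v.
  move=> uv /leP[[]//|[Z [Z1 leZ fZ _]]].
  by move: (le_source_part Z1 fZ leZ); rewrite uv eqxx.
by apply: R_anti; apply: same.
Qed.

Let le_trans y x z : le x y -> le y z -> le x z.
Proof.
(* If [x] leaves its part through [Z], then [Z] is an ancestor of [part y], hence of [part z], and
   still serves. Otherwise [x] lies in the part of [y] and inherits the way [y] reaches [z]. *)
case/leP=> [[xy Rxy]|[Z [Z1 leZ fZ RxZ]]] leyz; last first.
  apply/leP; right; exists Z; split=> //.
  by apply: (ple_trans _ _ _ leZ) (le_part leyz); rewrite ?partP ?in_part.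
case/leP: leyz => [[yz Ryz]|[Z [Z1 leZ fZ RyZ]]]; apply/leP.
  by left; split; [rewrite xy | apply: R_trans Ryz].
by right; exists Z; split=> //; [rewrite xy | apply: R_trans RyZ].
Qed.

Let le_refl x : le x x. Proof. by apply/leP; left. Qed.

Let poset_le : poset [set: V] le.
Proof.
split=> [x _|x y _ _ /andP[]|y x z _ _ _]; first exact: le_refl.
  exact: le_anti.
exact: le_trans.
Qed.

(** Induction on [y] through a lower cover [p] above [x]. When [p] and [y] are in different parts,
    condition (4) for [sources] yields the second disjunct of [le]. *)
Let sub_le x y : R x y -> le x y.
Proof.
elim/(poset_ind posR): y / (in_setT y) => y _ IHy Rxy.
have [<-//|xy] := eqVneq x y.
have [p cov_py Rxp] := covers_below posR (in_setT _) (in_setT _) Rxy xy.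
have /(coversP)[_ _ py Rpy _] := cov_py.
apply: le_trans (IHy p (in_setT _) Rpy py Rxp) _; apply/leP.
have [eq_py|neq_py] := eqVneq (part p) (part y); [by left | right].
case: dec => _ [_ _ _ /(_ _ sources_ancestor p y)].
case/(_ _ _ cov_py (partP p) (partP y) (mem_part p) (mem_part y) neq_py).
move=> _ /imsetP[Z /setIdP[Z1 leZ] ->] /and3P[_ fZ RpZ].
by exists Z; split=> //; apply: part_eq.
Qed.

Let le_chain x y z : le y x -> le z x -> le y z || le z y.
Proof.
(* A crossing depends on its target only through the part of the target, so it reaches every element
   of [part x]. *)
have mixed u v : part u = part x -> le v x -> part v != part x -> le v u.
  move=> ux /leP[[-> _]|[Z [Z1 leZ fZ RvZ]] _]; first by rewrite eqxx.
  by apply/leP; right; exists Z; rewrite ux.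
have [yx|yx] := eqVneq (part y) (part x);
  have [zx|zx] := eqVneq (part z) (part x).
- move=> leyx lezx.
  have same u : part u = part x -> le u x -> R u x.
    move=> ux /leP[[]//|[Z [Z1 leZ fZ _]]].
    by move: (le_source_part Z1 fZ leZ); rewrite ux eqxx.
  have := part_chain yx zx (same y yx leyx) (same z zx lezx).
  by case/orP=> /sub_le ->; rewrite ?orbT.
- by move=> _ lezx; rewrite (mixed y z) ?orbT.
- by move=> leyx _; rewrite (mixed z y).
case/leP=> [[/eqP]|[Z1 [Z1P leZ1 fZ1 RyZ1]]]; first by rewrite (negPf yx).
case/leP=> [[/eqP]|[Z2 [Z2P leZ2 fZ2 RzZ2]]]; first by rewrite (negPf zx).
(* Both crossings use ancestors of [part x], which are comparable. If they coincide, [y] and [z] lie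
   below one source in one part; otherwise the upper bound set by the lower crossing already reaches
   the part of the other element. *)
have [eqZ|neqZ] := eqVneq Z1 Z2.
  subst Z2; have := part_chain (esym fZ1) (esym fZ2) RyZ1 RzZ2.
  by case/orP=> /sub_le ->; rewrite ?orbT.
have := ple_chain (partP x) (in_part Z1P) (in_part Z2P) leZ1 leZ2.
case/orP=> [le12|le21]; apply/orP.
  left; apply/leP; right; exists Z1; split=> //; rewrite -fZ2.
  by have [] := ple_below (in_part Z1P) (in_part Z2P) le12 neqZ.
right; apply/leP; right; exists Z2; split=> //; rewrite -fZ1.
by have [] := ple_below (in_part Z2P) (in_part Z1P) le21; rewrite // eq_sym.
Qed.

Let le_arboreal : arboreal_extension [set: V] R le.
Proof.
split; first by split=> // x y _ _; apply: sub_le.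
apply/(arborealP poset_le); split=> [|x y z _ _ _]; last exact: le_chain.
exists r; apply/(is_rootP poset_le); split=> // y _; apply: sub_le.
by have [_ ->] := (is_rootP posR r).1 root_r.
Qed.

Let part_rho X : X \in P -> part (rho X) = X.
Proof. by move=> XP; rewrite (part_eq XP) ?mem_rho. Qed.

Let source_le_rho X : X \in P :\ rP -> le (f X) (rho X).
Proof.
move=> X1; apply/leP; right; exists X; rewrite part_rho ?in_part //.
by split=> //; apply: poset_refl poset_ple _ (in_part X1).
Qed.

Let rho_le X y : X \in P -> ple X (part y) -> le (rho X) y.
Proof.
move=> XP leX; apply/leP; rewrite part_rho //.
have [eqX|neqX] := eqVneq X (part y); first by left; rewrite rho_min ?eqX.
have [Z [Z1 fZ leZ]] := ple_above XP leX neqX; right; exists Z; split=> //.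
by rewrite rho_min // -fZ.
Qed.

Let source_neq X : X \in P :\ rP -> f X != rho X.
Proof. by move/source_notR; apply: contraNneq => ->. Qed.

(** A part is recovered from its root, so non-root parts give distinct pairs; the extra one is
    [rP]. *)
Lemma card_source_pairs : #|P| = #|source_pairs P rho rP f|.+1.
Proof.
have rPP : rP \in P by case: dec => _ [_ [posQ /(is_rootP posQ)[rPP _]] _ _].
rewrite (cardsD1 rP) rPP card_in_imset // => X Y X1 Y1 [_ eq_rho].
by rewrite -[LHS](part_rho (in_part X1)) eq_rho part_rho ?in_part.
Qed.

Lemma jumps_of_decomposition :
  exists R', [/\ arboreal_extension [set: V] R R',
    #|P| = #|jumps [set: V] R R'|.+1
    & jumps [set: V] R R' = source_pairs P rho rP f].
Proof.
suff eq_jumps : jumps [set: V] R le = source_pairs P rho rP f.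
  by exists le; rewrite eq_jumps -card_source_pairs.
apply/setP=> -[x y]; rewrite inE /=; apply/andP/imsetP => [[]|[X X1 [-> ->]]].
  case/coversP=> _ _ xy lexy btw; rewrite /pcomparable /= negb_or.
  case/andP=> nRxy _; case/leP: lexy => [[_]|[Z [Z1 leZ fZ RxZ]]].
    by rewrite (negPf nRxy).
  (* A jump from [x] to [y] must cross parts, giving the chain [x], [f Z], [rho Z], [y]. Since [y]
     covers [x] and the middle pair is distinct, the ends coincide with it. *)
  have leZy := rho_le (in_part Z1) leZ; have leZZ := source_le_rho Z1.
  have lexZ := sub_le RxZ; have nZ := source_neq Z1.
  exists Z => //.
  have [fx|fy] := btw (f Z) (in_setT _) lexZ (le_trans leZZ leZy); last first.
    by case/eqP: nZ; apply: le_anti => //; rewrite fy.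
  have [rx|->] := btw (rho Z) (in_setT _) (le_trans lexZ leZZ) leZy.
    by case/eqP: nZ; rewrite fx rx.
  by rewrite fx.
have XP := in_part X1; have lefX := source_le_rho X1.
have nX := source_neq X1; split; last first.
  rewrite /pcomparable /= negb_or source_notR //=.
  apply: contra nX => /sub_le ?; apply/eqP; exact: le_anti.
apply/coversP; split=> // w _ lefw lewr.
(* An intermediate [w] inside [X] equals its root. Otherwise [w] crosses by some [Z]: if [Z] is [X]
   then [w] is below [f X]; if not, [Z] is an ancestor of [part (f X)], hence of [part w], its own
   parent, which is absurd. *)
case/leP: (lewr) => [[]|[Z [Z1 leZ fZ RwZ]]].
  rewrite part_rho // => wX Rw; right; apply: R_anti => //.
  by rewrite rho_min // -wX.
rewrite part_rho // in leZ; left; apply: le_anti => //.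
have [eqZ|neqZ] := eqVneq Z X; first by rewrite -eqZ sub_le.
have [_ leZf] := ple_below (in_part Z1) XP leZ neqZ.
have leZw := ple_trans (in_part Z1) (partP _) (partP _) leZf (le_part lefw).
by have := le_source_part Z1 fZ leZw; rewrite eqxx.
Qed.

End Construction.

(** * From an arboreal extension to a decomposition *)

Section Decomposing.
Variables (V : finType) (R A : rel V) (r : V).
Hypotheses (posR : poset [set: V] R) (root_r : is_root [set: V] R r).
Hypothesis extA : arboreal_extension [set: V] R A.

Let posA : poset [set: V] A. Proof. by case: extA => -[]. Qed.

Let A_refl x : A x x. Proof. exact: poset_refl posA _ (in_setT x). Qed.
Let A_trans y x z : A x y -> A y z -> A x z.
Proof. exact: (poset_trans posA) (in_setT _) (in_setT _) (in_setT _). Qed.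
Let A_anti x y : A x y -> A y x -> x = y.
Proof. exact: (poset_anti posA) (in_setT _) (in_setT _). Qed.
Let A_chain x y z : A y x -> A z x -> A y z || A z y.
Proof.
by case: extA => _ /(arborealP posA)[_]; apply; apply: in_setT.
Qed.

Let R_trans y x z : R x y -> R y z -> R x z.
Proof. exact: (poset_trans posR) (in_setT _) (in_setT _) (in_setT _). Qed.

Let sub_A x y : R x y -> A x y.
Proof. by case: extA => -[_ RA] _; apply: RA; apply: in_setT. Qed.

Let A_root x : A r x.
Proof. by apply: sub_A; have [_ ->] := (is_rootP posR r).1 root_r. Qed.

(** The elements below [y] form a chain in which [p] comes directly before [y]. It follows that
    lower covers in [A] are unique. *)
Let covers_anc p x y : covers [set: V] A p y -> A x y -> x != y -> A x p.
Proof.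
case/coversP=> _ _ py Apy btw Axy xy.
case/orP: (A_chain Axy Apy) => // Apx.
by case: (btw x (in_setT _) Apx Axy) => [->//|/eqP]; rewrite (negPf xy).
Qed.

Let covers_inj p q y : covers [set: V] A p y -> covers [set: V] A q y -> p = q.
Proof.
move=> cov_p cov_q; case/coversP: (cov_p) => _ _ py Apy _.
case/coversP: (cov_q) => _ _ qy Aqy _.
by apply: A_anti; [apply: covers_anc Apy py | apply: covers_anc Aqy qy].
Qed.

Let heads : {set V} := r |: [set p.2 | p in jumps [set: V] R A].

Let head x : V :=
  [arg max_(t > r | (t \in heads) && A t x) #|down [set: V] A t|].

(** The root [r] makes the choice possible. The heads below [x] form a chain, so the one with the
    largest down-set is the greatest. *)
Let headP x : [/\ head x \in heads, A (head x) x
  & forall t, t \in heads -> A t x -> A t (head x)].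
Proof.
rewrite /head; case: arg_maxnP => [|t /andP[ht Atx] max_t].
  by rewrite setU11 A_root.
split=> // u hu Aux; case/orP: (A_chain Aux Atx) => // Atu.
have [->//|tu] := eqVneq t u.
have := max_t u; rewrite hu Aux => /(_ isT) /=.
by rewrite leqNgt (ltn_card_down posA).
Qed.

Let head_head x : head x \in heads. Proof. by case: (headP x). Qed.
Let head_le x : A (head x) x. Proof. by case: (headP x). Qed.
Let head_max x t : t \in heads -> A t x -> A t (head x).
Proof. by case: (headP x) => _ _; apply. Qed.
Let head_id t : t \in heads -> head t = t.
Proof. by move=> ht; apply: A_anti => //; apply: head_max. Qed.
Let head_homo x y : A x y -> A (head x) (head y).
Proof. by move=> Axy; apply: head_max => //; apply: A_trans Axy. Qed.

Let same_head_R x y : head x = head y -> A x y -> R x y.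
Proof.
elim/(poset_ind posA): y / (in_setT y) => y _ IHy eq_h Axy.
have [->|xy] := eqVneq x y; first exact: poset_refl posR _ (in_setT _).
have [p cov_py Axp] := covers_below posA (in_setT _) (in_setT _) Axy xy.
have /coversP[_ _ py Apy _] := cov_py.
have eq_p : head x = head p.
  by apply: A_anti; [|rewrite eq_h]; apply: head_homo.
have Rpy : R p y.
  (* A head [y] would equal [head y], hence [head x], and so lie below [x]. Not being a jump target,
     [y] is comparable in [R] with its lower cover [p]. *)
  have : y \notin heads.
    apply: contra xy => /head_id hy; apply/eqP/A_anti => //.
    by rewrite -hy -eq_h.
  rewrite in_setU1 negb_or => /andP[_]; apply: contraNT => nRpy.
  apply/imsetP; exists (p, y) => //; rewrite inE /= cov_py /pcomparable /=.
  rewrite negb_or nRpy /=; apply: contra py => /sub_A Ayp.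
  by apply/eqP/A_anti.
by apply: R_trans Rpy; apply: IHy.
Qed.

Let part t : {set V} := [set x | head x == t].
Let P : {set {set V}} := [set part t | t in heads].
(** Members of a part share their head, so any of them determines its root; the default [r] is
    reached only by the empty set. *)
Let rho (X : {set V}) : V := head (odflt r [pick x in X]).
Let rP : {set V} := part r.
Let f X : V := odflt r [pick x | (x, rho X) \in jumps [set: V] R A].

Let part_in x : part (head x) \in P. Proof. exact: imset_f. Qed.

Let rho_part t : t \in heads -> rho (part t) = t.
Proof.
move=> ht; rewrite /rho; case: pickP => [x|/(_ t)] /[!inE]; first by move/eqP.
by rewrite head_id ?eqxx.
Qed.

Let rho_head X : rho X \in heads. Proof. exact: head_head. Qed.

Let mem_parts X x : X \in P -> (x \in X) = (head x == rho X).
Proof. by case/imsetP=> t ht ->; rewrite rho_part // inE. Qed.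

Let mem_rho X : X \in P -> rho X \in X.
Proof. by move=> XP; rewrite mem_parts // head_id. Qed.

Let rho_inj : {in P &, injective rho}.
Proof.
by move=> X Y XP YP eq_rho; apply/setP=> x; rewrite !mem_parts ?eq_rho.
Qed.

Let rPP : rP \in P. Proof. by apply: imset_f; apply: setU11. Qed.
Let rho_rP : rho rP = r. Proof. by apply: rho_part; apply: setU11. Qed.

(** The root of a part other than [rP] is a head different from [r], hence a jump target, so the
    choice in [f] never falls back on its default. *)
Let fP X : X \in P :\ rP -> (f X, rho X) \in jumps [set: V] R A.
Proof.
case/setD1P=> XrP XP; rewrite /f; case: pickP => //= no_jump.
have := rho_head X; rewrite in_setU1.
case/predU1P=> [rhoX|/imsetP[[x y] Jxy /= rhoX]].
  by case/eqP: XrP; apply: rho_inj => //; rewrite rho_rP.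
by have := no_jump x; rewrite rhoX Jxy.
Qed.

Let f_covers X : X \in P :\ rP -> covers [set: V] A (f X) (rho X).
Proof. by move/fP; rewrite inE => /andP[]. Qed.

Let f_neq X : X \in P :\ rP -> head (f X) != rho X.
Proof.
move=> X1; have /coversP[_ _ nX AX _] := f_covers X1.
apply: contraNneq nX => hf; apply/eqP/A_anti => //.
by rewrite -hf.
Qed.

Let f_head X : X \in P :\ rP -> A (head (f X)) (rho X).
Proof.
by move=> X1; have /coversP[_ _ _ + _] := f_covers X1; apply: A_trans.
Qed.

Let partition_P : partition P [set: V].
Proof.
apply/and3P; split.
- apply/eqP/setP=> x; rewrite inE; apply/bigcupP; exists (part (head x)) => //.
  by rewrite inE.
- apply/trivIsetP=> X Y XP YP; apply: contraNT => /pred0Pn[x] /=.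
  rewrite !mem_parts // => /andP[/eqP hX /eqP hY].
  by apply/eqP/rho_inj => //; rewrite -hX.
apply/imsetP=> -[t ht /setP/(_ t)].
by rewrite !inE head_id ?eqxx.
Qed.

(** On elements with the same head [A] and [R] agree, so the chain condition is inherited from
    [A]. *)
Let parts_arboreal_P : parts_arboreal R P rho.
Proof.
move=> X XP; have posX : poset X (induced R X).
  exact: (poset_induced posR (subsetT X)).
have rhoX : is_root X (induced R X) (rho X).
  apply/(is_rootP posX); split=> [|x xX].
    exact: mem_rho.
  rewrite /induced /= xX mem_parts // head_id ?rho_head ?eqxx //=.
  move: xX; rewrite mem_parts // => /eqP <-.
  by apply: same_head_R => //; apply: head_id.
split=> //; apply/(arborealP posX); split; first by exists (rho X).
move=> x y z xX yX zX /and3P[_ _ Ryx] /and3P[_ _ Rzx].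
rewrite /induced /= yX zX /=.
move: yX zX; rewrite !mem_parts // => /eqP hy /eqP hz.
case/orP: (A_chain (sub_A Ryx) (sub_A Rzx)) => /same_head_R ->;
  by rewrite ?orbT ?hy.
Qed.

Let le : rel {set V} := [rel X Y | A (rho X) (rho Y)].

Let le_refl : reflexive le. Proof. by move=> X; apply: A_refl. Qed.
Let le_trans : transitive le. Proof. by move=> Y X Z; apply: A_trans. Qed.

Let quotient_refl : {in P, reflexive (quotient_rel R P)}.
Proof.
move=> X XP; rewrite /quotient_rel /= XP /=.
have rhoX := mem_rho XP.
apply/exists_inP; exists (rho X) => //; apply/exists_inP; exists (rho X) => //.
exact: poset_refl posR _ (in_setT _).
Qed.

Let quotient_le X Y : X \in P -> quotient_closure R P X Y -> le X Y.
Proof.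
move=> XP; rewrite /quotient_closure (tclosureE quotient_refl) //.
apply: (connect_min le_refl le_trans) => {XP}X {}Y /=.
case/and3P=> XP YP /exists_inP[x xX /exists_inP[y yY Rxy]].
move: xX yY; rewrite /le /= !mem_parts // => /eqP <- /eqP <-.
exact/head_homo/sub_A.
Qed.

(** Antisymmetry is pulled back from [A] along the injective [rho]. This serves both the quotient
    closure and the parent closure. *)
Let poset_le E : {in P, reflexive E} ->
  (forall X Y, X \in P -> tclosure E X Y -> le X Y) -> poset P (tclosure E).
Proof.
move=> Erefl Ele; split=> [X XP|X Y XP YP /andP[XY YX]|Y X Z YP XP ZP].
- by rewrite (tclosureE Erefl).
- by apply: rho_inj => //; apply: A_anti; apply: Ele.
by rewrite !(tclosureE Erefl) //; apply: connect_trans.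
Qed.

Let quotient_rooted_P : quotient_rooted R P rP.
Proof.
have posQ := poset_le quotient_refl quotient_le.
split=> //; apply/(is_rootP posQ); split=> // X XP.
rewrite (tclosureE quotient_refl) // connect1 //=.
rewrite /quotient_rel /= rPP XP /=.
apply/exists_inP; exists r; first by rewrite inE head_id ?setU11.
apply/exists_inP; exists (rho X); first by rewrite mem_rho.
by have [_ ->] := (is_rootP posR r).1 root_r.
Qed.

Let parent_refl : {in P, reflexive (parent_rel P rP f)}.
Proof. by move=> X XP; rewrite /parent_rel /= XP eqxx. Qed.

Let parent_le X Y : X \in P -> parent_closure P rP f X Y = (Y \in P) && le X Y.
Proof.
move=> XP; rewrite /parent_closure (tclosureE parent_refl) //.
apply/idP/andP=> [cXY|[YP]].
  have [<-|XY] := eqVneq X Y; first by [].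
  split; first by have [Z [_ _ /and3P[]]] := connect_last cXY XY.
  apply: (connect_min le_refl le_trans) cXY => {XP XY}X {}Y /= /and3P[XP YP].
  case/predU1P=> [->//|/andP[Y1]]; rewrite /le /= mem_parts // => /eqP <-.
  exact: f_head.
rewrite /le /=; move def_y: (rho Y) => y.
elim/(poset_ind posA): y / (in_setT y) Y YP def_y => y _ IHy Y YP def_y.
have [eqX|neqX] := eqVneq X Y; first by rewrite eqX connect0.
have rho_f : rho (part (head (f Y))) = head (f Y) by rewrite rho_part.
move=> leXY; have neq_rho : rho X != rho Y.
  by apply: contraNneq neqX => /rho_inj ->.
have Y1 : Y \in P :\ rP.
  rewrite in_setD1 YP andbT; apply: contraNneq neq_rho => eqY.
  apply/eqP/A_anti; first by rewrite def_y.
  by rewrite eqY rho_rP.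
(* The path goes through the parent of [Y]: [rho X] is strictly below [rho Y], hence below its lower
   cover [f Y], and being a head it is below [head (f Y)]. *)
apply: (@connect_trans _ _ (part (head (f Y)))).
  apply: (IHy (head (f Y))) => //.
  - by rewrite -def_y f_head.
  - by rewrite -def_y f_neq.
  apply: head_max; first exact: rho_head.
  by apply: covers_anc (f_covers Y1) _ neq_rho; rewrite def_y.
by apply: connect1; rewrite /parent_rel /= part_in YP Y1 inE eqxx orbT.
Qed.

Let sources_arboreal_P : sources_arboreal R P rho rP f.
Proof.
split=> [X X1|].
  split; last first.
    by have := fP X1; rewrite inE /= /pcomparable /= negb_or => /and3P[].
  exists (part (head (f X))); split=> //; last by rewrite inE.
  by apply: contraNneq (f_neq X1) => eqX; rewrite -[in rho X]eqX rho_part.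
have posB : poset P (parent_closure P rP f).
  apply: (poset_le parent_refl) => X Y XP cXY.
  by have /andP[] : (Y \in P) && le X Y by rewrite -parent_le.
split; first by split=> // X Y XP YP /(quotient_le XP); rewrite parent_le ?YP.
apply/(arborealP posB); split.
  exists rP; apply/(is_rootP posB); split=> // X XP.
  by rewrite parent_le // XP /le /= rho_rP A_root.
move=> X Y Z XP YP ZP; rewrite !parent_le // XP YP ZP /=.
exact: A_chain.
Qed.

Let sources_cover_P : sources_cover R P rP f.
Proof.
move=> g [_ g_eq] x y U W /coversP[_ _ _ Rxy _] UP WP xU yW UW.
(* The claim is proved for all [A]-related pairs in distinct parts, by induction on [rho W], so that
   it can be applied again with [f W] in place of [y]. *)
move/sub_A: Rxy; move def_w: (rho W) => w.
elim/(poset_ind posA): w / (in_setT w) W WP def_w y yW UW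
  => w _ IHw W WP def_w y yW UW Axy.
have hx : head x = rho U by apply/eqP; rewrite -mem_parts.
have hy : head y = rho W by apply/eqP; rewrite -mem_parts.
have neq_rho : rho U != rho W by apply: contraNneq UW => /rho_inj ->.
have nAwx : ~~ A (rho W) x.
  apply: contra neq_rho => Awx; apply/eqP/A_anti.
    by rewrite -hx -hy head_homo.
  by rewrite -hx head_max ?rho_head.
have Axw : A x (rho W).
  have Awy : A (rho W) y by rewrite -hy.
  by have := A_chain Axy Awy; rewrite (negPf nAwx) orbF.
have xw : x != rho W by apply: contraNneq nAwx => <-.
have W1 : W \in P :\ rP.
  rewrite in_setD1 WP andbT; apply: contraNneq nAwx => ->.
  by rewrite rho_rP.
have Axf := covers_anc (f_covers W1) Axw xw.
have fW' : f W \in part (head (f W)) by rewrite inE.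
rewrite (g_eq W _ W1 (part_in (f W)) fW').
(* Now [x] is below [f W]. If they share a part, [f W] is the source sought; otherwise the induction
   climbs to the parent of [W]. *)
have [eqU|neqU] := eqVneq U (part (head (f W))).
  exists (f W); first exact: setU11.
  rewrite /induced /= xU {1}eqU fW' /=; apply: same_head_R => //.
  by rewrite hx eqU rho_part.
have Afw : A (head (f W)) w by rewrite -def_w f_head.
have neq_fw : head (f W) != w by rewrite -def_w f_neq.
have rho_fw : rho (part (head (f W))) = head (f W) by rewrite rho_part.
have [z gz Rxz] :=
  IHw _ (in_setT _) Afw neq_fw _ (part_in _) rho_fw _ fW' neqU Axf.
by exists z => //; apply: setU1r.
Qed.

Lemma decomposition_of_jumps : exists P rho rP f,
  jump_decomposition R P rho rP f /\
  jumps [set: V] R A = source_pairs P rho rP f.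
Proof.
exists P, rho, rP, f; split=> //.
apply/setP=> -[x y]; apply/idP/imsetP => [Jxy|[X /fP JX [-> ->]]//].
have hy : y \in heads by apply/setU1r/imsetP; exists (x, y).
have rhoy := rho_part hy; have yP : part y \in P by apply: imset_f.
have y1 : part y \in P :\ rP.
  rewrite in_setD1 yP andbT.
  move: Jxy; rewrite inE /= => /andP[/coversP[_ _ xy Axy _] _].
  apply: contraNneq xy => /(congr1 rho); rewrite rhoy rho_rP => eq_y.
  by apply/eqP/A_anti => //; rewrite eq_y.
exists (part y) => //; rewrite rhoy; congr (_, _).
(* The source chosen by [f] is [x], because both are the unique lower cover of [y]. *)
have := f_covers y1; rewrite rhoy; apply: covers_inj.
by move: Jxy; rewrite inE => /andP[].
Qed.

End Decomposing.

(** * The equivalence, with the jumps matched in both directions *)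

Theorem theorem2p1 (V : finType) (R : rel V) (r : V) (s : nat)
  (hs : 1 <= s) (hR : poset [set: V] R) (hr : is_root [set: V] R r) :
  [/\ (exists R' : rel V,
         arboreal_extension [set: V] R R' /\ #|jumps [set: V] R R'| = s)
      <->
      (exists (P : {set {set V}}) (rho : {set V} -> V) (rP : {set V})
              (f : {set V} -> V),
         #|P| = s.+1 /\ jump_decomposition R P rho rP f),
      (forall R' : rel V,
         arboreal_extension [set: V] R R' -> #|jumps [set: V] R R'| = s ->
         exists (P : {set {set V}}) (rho : {set V} -> V) (rP : {set V})
                (f : {set V} -> V),
           [/\ #|P| = s.+1, jump_decomposition R P rho rP f
             & jumps [set: V] R R' = source_pairs P rho rP f])
    & (forall (P : {set {set V}}) (rho : {set V} -> V) (rP : {set V})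
              (f : {set V} -> V),
         #|P| = s.+1 -> jump_decomposition R P rho rP f ->
         exists R' : rel V,
           [/\ arboreal_extension [set: V] R R', #|jumps [set: V] R R'| = s
             & jumps [set: V] R R' = source_pairs P rho rP f])].
Proof.
have to_dec R' : arboreal_extension [set: V] R R' ->
    #|jumps [set: V] R R'| = s ->
    exists (P : {set {set V}}) rho rP f,
    [/\ #|P| = s.+1, jump_decomposition R P rho rP f
      & jumps [set: V] R R' = source_pairs P rho rP f].
  move=> extR' <-.
  have [P [rho [rP [f [dec eqJ]]]]] := decomposition_of_jumps hR hr extR'.
  by exists P, rho, rP, f; rewrite (card_source_pairs hR dec) eqJ.
have of_dec (P : {set {set V}}) rho rP f : #|P| = s.+1 ->
    jump_decomposition R P rho rP f ->
    exists R', [/\ arboreal_extension [set: V] R R',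
      #|jumps [set: V] R R'| = s
      & jumps [set: V] R R' = source_pairs P rho rP f].
  move=> cardP /(jumps_of_decomposition hR hr)[R' [extR' cardJ eqJ]].
  by exists R'; split=> //; apply: succn_inj; rewrite -cardJ.
split=> //; split=> [[R' [extR' /(to_dec R' extR')]]|].
  by case=> P [rho [rP [f [cardP dec _]]]]; exists P, rho, rP, f.
case=> P [rho [rP [f [cardP /(of_dec _ _ _ _ cardP)]]]].
by case=> R' [extR' cardJ _]; exists R'.
Qed.
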